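(* Let $$A=\begin{bmatrix}1&1&1&1\\0&1&1&0\\0&0&1&0\\0&0&1&1\end{bmatrix},\qquad B=\begin{bmatrix}1&1&1&1\\0&1&1&0\\0&0&1&0\\0&0&1&-1\end{bmatrix},$$ and let $X=AA^T$ and $Y=BB^T$. Let $x=(x_1,\ldots,x_4)$ and $y=(y_1,\ldots,y_4)$ be the vectors of the eigenvalues (listed with multiplicity) of $X$ and $Y$, respectively. Then $y$ is power majorized by $x$.
   Context: Power majorization: for two $m$-tuples of positive real numbers $a=(a_1,\ldots,a_m)$ and $b=(b_1,\ldots,b_m)$, $a$ is power majorized by $b$ if $\sum_{i=1}^m a_i^p\le\sum_{i=1}^m b_i^p$ for every real $p\ge 1$, and $\sum_{i=1}^m a_i^p\ge\sum_{i=1}^m b_i^p$ for every real $p$ with $0<p<1$. *)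

(* Defs.v *)
From mathcomp Require Import all_boot all_order all_algebra.
From mathcomp Require Import reals exp.

Set Implicit Arguments.
Unset Strict Implicit.
Unset Printing Implicit Defensive.

Import Order.TTheory GRing.Theory Num.Theory.
Local Open Scope ring_scope.

Definition mx_of_rows (R : realType) (m n : nat) (rows : seq (seq R)) :
  'M[R]_(m, n) := \matrix_(i < m, j < n) nth 0 (nth [::] rows i) j.

Definition matA (R : realType) : 'M[R]_4 := mx_of_rows 4 4
  [:: [:: 1; 1; 1; 1];
      [:: 0; 1; 1; 0];
      [:: 0; 0; 1; 0];
      [:: 0; 0; 1; 1]].

Definition matB (R : realType) : 'M[R]_4 := mx_of_rows 4 4
  [:: [:: 1; 1; 1;  1];
      [:: 0; 1; 1;  0];
      [:: 0; 0; 1;  0];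
      [:: 0; 0; 1; -1]].

(* [x] lists the eigenvalues of [M] with algebraic multiplicity, in some
   order. *)
Definition eigenvalues_of (R : realType) (n : nat) (M : 'M[R]_n)
  (x : n.-tuple R) : Prop :=
  char_poly M = \prod_(i < n) ('X - (tnth x i)%:P).

(* The notion is only defined for tuples of positive reals, so positivity is
   part of the predicate. *)
Definition power_majorized (R : realType) (m : nat) (a b : m.-tuple R) :
  Prop :=
  [/\ forall i, 0 < tnth a i,
      forall i, 0 < tnth b i,
      forall p : R, 1 <= p ->
        \sum_(i < m) tnth a i `^ p <= \sum_(i < m) tnth b i `^ p
    & forall p : R, 0 < p -> p < 1 ->
        \sum_(i < m) tnth a i `^ p >= \sum_(i < m) tnth b i `^ p].

(* Main.v *)
Require Import Defs.
From mathcomp Require Import all_boot all_order all_algebra.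
From mathcomp Require Import reals exp.
From mathcomp Require Import boolp classical_sets functions.
From mathcomp Require Import topology normedtype sequences.
From mathcomp Require Import ring lra.

Local Open Scope ring_scope.
Import Order.TTheory GRing.Theory Num.Theory numFieldNormedType.Exports.

(** The characteristic polynomials of [X = A A^T] and [Y = B B^T] are
[(t - 1)^2 (t^2 - 7 t + 1)] and [(t^2 - 3 t + 1) (t^2 - 6 t + 1)] ([char_polyA]
and [char_polyB]). A palindromic factor [t^2 - s t + 1] with [s >= 2] has the
roots [e^r] and [e^(-r)], where [h r = s] for [h r = e^r + e^(-r)]. Choosing
nonnegative [a], [b], [c] with [h a = 7], [h b = 3], [h c = 6], the difference
of the two power sums of exponent [p] is
[F p = h (a p) + 2 - h (b p) - h (c p)].

The function [F] vanishes at [1] because [7 + 2 = 3 + 6], and it is an even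
power series in [p] without constant term, whose coefficient of degree [2k > 0]
is [2 (a^(2k) - b^(2k) - c^(2k)) / (2k)!]. Since [b, c < a], these coefficients
change sign once, from nonpositive to nonnegative. As in Descartes' rule of
signs, comparing [F p] with [p^K * F 1 = 0] term by term, where [K] is the
degree at which the sign changes, gives [F p >= 0] for [p >= 1] and [F p <= 0]
for [0 <= p <= 1] ([cvg_series_sign] and [cosh2_ineq]). *)

(** * Power series whose coefficients change sign once *)

(** If the coefficients are nonpositive before [K] and nonnegative from [K] on,
and the series vanishes at [1], then its sign at [p] is known: each term
[a n * p ^+ n] compares with [a n * p ^+ K], whichever side of [K] the index
lies on. *)

Lemma cvg_series_sign {R : realType} {a : R^nat} {K : nat} {p l : R} :
    (forall n, (n < K)%N -> a n <= 0) -> (forall n, (K <= n)%N -> 0 <= a n) ->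
    (series a @ \oo --> (0 : R))%classic ->
    (series (fun n => a n * p ^+ n) @ \oo --> l)%classic ->
  (1 <= p -> 0 <= l) /\ (0 <= p -> p <= 1 -> l <= 0).
Proof.
move=> a_le0 a_ge0 cvg0 cvgl.
have cvgK : ((fun n => p ^+ K * series a n) @ \oo --> (0 : R))%classic.
  by rewrite -(mulr0 (p ^+ K)); apply: cvgMr.
split=> [p1|p0 p1].
  apply: ler_cvg_to cvgK cvgl _; apply: nearW => n.
  rewrite /series /= mulr_sumr; apply: ler_sum => i _; rewrite mulrC.
  have [iK|Ki] := ltnP i K.
    by apply: ler_wnM2l; [exact: a_le0 | rewrite ler_weXn2l // ltnW].
  by apply: ler_wpM2l; [exact: a_ge0 | rewrite ler_weXn2l].
apply: ler_cvg_to cvgl cvgK _; apply: nearW => n.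
rewrite /series /= mulr_sumr; apply: ler_sum => i _; rewrite [leRHS]mulrC.
have [iK|Ki] := ltnP i K.
  by apply: ler_wnM2l; [exact: a_le0 | rewrite ler_wiXn2l // ltnW].
by apply: ler_wpM2l; [exact: a_ge0 | rewrite ler_wiXn2l].
Qed.

(** * Twice the hyperbolic cosine *)

(** [cosh2 t] is [2 cosh t]. *)
Definition cosh2 {R : realType} (t : R) : R := expR t + expR (- t).

Lemma cosh2_mono {R : realType} (s t : R) :
  0 <= s -> s <= t -> cosh2 s <= cosh2 t.
Proof.
move=> s0 st; rewrite /cosh2 !expRN.
have u1 : 1 <= expR s by rewrite -expR0 ler_expR.
have uv : expR s <= expR t by rewrite ler_expR.
move: (expR s) (expR t) u1 uv => u v u1 uv.
have u0 : u != 0 by lra.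
have v0 : v != 0 by lra.
rewrite -subr_ge0.
have -> : v + v^-1 - (u + u^-1) = (v - u) * (u * v - 1) / (u * v).
  by field; rewrite u0 v0.
have uv1 : 1 <= u * v by rewrite mulr_ege1 // (le_trans u1).
by rewrite divr_ge0 ?mulr_ge0 //; lra.
Qed.

Lemma cosh2_lt {R : realType} (s t : R) :
  0 <= t -> cosh2 s < cosh2 t -> s < t.
Proof.
by move=> t0; apply: contraTT; rewrite -!leNgt; exact: cosh2_mono.
Qed.

Lemma cosh2_surj {R : realType} (c : R) :
  2 <= c -> exists2 t : R, 0 <= t & cosh2 t = c.
Proof.
(* [u] is the larger root of [u ^+ 2 - c * u + 1], and [t = ln u]. *)
move=> c2; pose u := (c + Num.sqrt (c ^+ 2 - 4)) / 2.
have d0 : 0 <= c ^+ 2 - 4 by nra.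
have s0 := sqrtr_ge0 (c ^+ 2 - 4); have sE := sqr_sqrtr d0.
have u1 : 1 <= u by rewrite /u; lra.
have uE : u ^+ 2 = c * u - 1.
  rewrite /u; move: (Num.sqrt _) sE => s sE.
  have -> : c * ((c + s) / 2) - 1
            = (c ^+ 2 + 2 * c * s + (c ^+ 2 - 4)) / 4 by field.
  by rewrite -sE; field.
have u0 : 0 < u by lra.
exists (ln u); first exact: ln_ge0.
rewrite /cosh2 expRN lnK ?posrE //; apply: (mulfI (lt0r_neq0 u0)).
rewrite mulrDr divff ?lt0r_neq0 // -expr2 uE; ring.
Qed.

Lemma expr_add_le_exists {R : realType} (a b c : R) :
    0 <= b -> b < a -> 0 <= c -> c < a ->
  exists n, b ^+ n + c ^+ n <= a ^+ n.
Proof.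
move=> b0 ba c0 ca; have a0 : 0 < a by lra.
have cvgq (d : R) : 0 <= d -> d < a ->
    ((GRing.exp (d / a) : R^nat) @ \oo --> (0 : R))%classic.
  move=> d0 da; apply: cvg_expr.
  by rewrite ger0_norm ?divr_ge0 ?(ltW a0) // ltr_pdivrMr // mul1r.
have lim0 : (((fun n => (b / a) ^+ n + (c / a) ^+ n) : R^nat) @ \oo
    --> (0 : R))%classic.
  by rewrite -(addr0 0); apply: cvgD; exact: cvgq.
have [n _ /(_ n (leqnn n))] := cvgr_lt _ lim0 1 ltr01.
rewrite /= !expr_div_n -mulrDl ltr_pdivrMr ?exprn_gt0 // mul1r => /ltW.
by exists n.
Qed.

(** The function [F p = cosh2 (a * p) + 2 - cosh2 (b * p) - cosh2 (c * p)], which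
vanishes at [1], is nonnegative beyond [1] and nonpositive between [0] and [1].
*)
Lemma cosh2_ineq {R : realType} (a b c p : R) :
    0 <= b -> b < a -> 0 <= c -> c < a -> cosh2 a + 2 = cosh2 b + cosh2 c ->
  (1 <= p -> cosh2 (b * p) + cosh2 (c * p) <= cosh2 (a * p) + 2) /\
  (0 <= p -> p <= 1 -> cosh2 (a * p) + 2 <= cosh2 (b * p) + cosh2 (c * p)).
Proof.
move=> b0 ba c0 ca F1.
(* [f q] lists the terms of the exponential series that add up to [F q]; the
   constant [2] enters as [2 * expR 0]. *)
pose f (q : R) : R^nat := exp_coeff (a * q) + exp_coeff (- (a * q))
  + 2 *: exp_coeff 0 - exp_coeff (b * q) - exp_coeff (- (b * q))
  - exp_coeff (c * q) - exp_coeff (- (c * q)).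
pose F (q : R) : R := cosh2 (a * q) + 2 - (cosh2 (b * q) + cosh2 (c * q)).
have cvgF q : (series (f q) @ \oo --> F q)%classic.
  have cvge (x : R) : (series (exp_coeff x) @ \oo --> expR x)%classic.
    exact: is_cvg_series_exp_coeff.
  have -> : F q = expR (a * q) + expR (- (a * q)) + 2 *: expR 0
      - expR (b * q) - expR (- (b * q)) - expR (c * q) - expR (- (c * q)).
    by rewrite /F /cosh2 expR0 /GRing.scale /=; ring.
  have seriesB (u v : R^nat) : series (u - v) = series u - series v.
    by rewrite seriesD seriesN.
  rewrite /f !seriesB !seriesD seriesZ.
  do 4![apply: cvgB; last exact: cvge].
  by do 2?[apply: cvgD; try exact: cvge]; apply: cvgZr; exact: cvge.
(* The coefficients of [F] as a power series; the factor [1 + (-1) ^+ n] kills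
   the odd ones, and the two contributions to [g 0] cancel. *)
pose g n : R := ((n == 0%N)%:R *+ 2
  + (1 + (-1) ^+ n) * (a ^+ n - (b ^+ n + c ^+ n))) / n`!%:R.
have fE q : f q = fun n => g n * q ^+ n.
  apply/funext => n; rewrite /g.
  pose e (x : R) := x ^+ n / n`!%:R.
  transitivity (e (a * q) + e (- (a * q)) + 2 * e 0 - e (b * q) - e (- (b * q))
    - e (c * q) - e (- (c * q))); first by [].
  rewrite /e 3!(exprNn (_ * q)) !exprMn expr0n.
  move: (n`!%:R)^-1 => {}e.
  by case: n => [|n] /=; ring.
have : exists n, b ^+ n + c ^+ n <= a ^+ n by exact: expr_add_le_exists.
(* The sign changes at the least exponent for which [a] dominates. *)
case/ex_minnP => K HK minK.
have a0 : 0 < a by lra.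
have geK n : (K <= n)%N -> b ^+ n + c ^+ n <= a ^+ n.
  move=> /subnK <-; elim: (n - K)%N => [//|m IHm].
  rewrite addSn !exprS; have := exprn_ge0 (m + K) b0.
  have := exprn_ge0 (m + K) c0; nra.
have sgn_ge0 n : 0 <= 1 + (-1) ^+ n :> R.
  by rewrite -signr_odd; case: (odd n); rewrite ?expr0 ?expr1; lra.
have K_gt0 : (0 < K)%N.
  by rewrite lt0n; apply: contraTneq HK => ->; rewrite !expr0 -ltNge; lra.
have g_le0 n : (n < K)%N -> g n <= 0.
  move=> nK; rewrite /g pmulr_lle0 ?invr_gt0 ?ltr0n ?fact_gt0 //.
  have [->|n0] := eqVneq n 0%N; first by rewrite /= !expr0; lra.
  rewrite mul0rn add0r mulr_ge0_le0 // subr_le0 ltW // ltNge.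
  by apply: contraL nK => /minK; rewrite -leqNgt.
have g_ge0 n : (K <= n)%N -> 0 <= g n.
  move=> Kn; rewrite /g mulr_ge0 ?invr_ge0 ?ler0n //.
  by rewrite addr_ge0 ?mulrn_wge0 ?mulr_ge0 ?subr_ge0 ?geK ?ler0n.
have cvg1 : (series g @ \oo --> (0 : R))%classic.
  have := cvgF 1; rewrite fE /F !mulr1 F1 subrr.
  by under [in X in series X]eq_fun do rewrite expr1n mulr1.
have := cvgF p; rewrite fE => cvgp.
by have [] := cvg_series_sign g_le0 g_ge0 cvg1 cvgp; rewrite subr_ge0 subr_le0.
Qed.

(** * Characteristic polynomials of the two Gram matrices *)

(** Laplace expansion along the first row, for a matrix whose entries are given
by a function on [nat], so that minors are again of this form. *)
Lemma det_fun_expand {R : comNzRingType} (n : nat) (f : nat -> nat -> R) :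
  \det (\matrix_(i < n.+1, j < n.+1) f i j) =
  \sum_(j < n.+1) f 0%N j * ((-1) ^+ j *
     \det (\matrix_(i < n, k < n) f i.+1 (bump j k))).
Proof.
rewrite (expand_det_row _ ord0); apply: eq_bigr => j _; rewrite mxE /cofactor.
congr (_ * (_ * \det _)).
by apply/matrixP => i k; rewrite !mxE.
Qed.

Lemma det_fun2 {R : comNzRingType} (f : nat -> nat -> R) :
  \det (\matrix_(i < 2, j < 2) f i j) =
  f 0%N 0%N * f 1%N 1%N - f 0%N 1%N * f 1%N 0%N.
Proof.
rewrite det_fun_expand !big_ord_recl big_ord0 !det_mx11 !mxE /=.
rewrite /bump /= !(addn0, add1n, add0n); ring.
Qed.

Lemma det_fun3 {R : comNzRingType} (f : nat -> nat -> R) :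
  \det (\matrix_(i < 3, j < 3) f i j) =
    f 0%N 0%N * (f 1%N 1%N * f 2%N 2%N - f 1%N 2%N * f 2%N 1%N)
  - f 0%N 1%N * (f 1%N 0%N * f 2%N 2%N - f 1%N 2%N * f 2%N 0%N)
  + f 0%N 2%N * (f 1%N 0%N * f 2%N 1%N - f 1%N 1%N * f 2%N 0%N).
Proof.
rewrite det_fun_expand.
under eq_bigr => j _ do rewrite (det_fun2 (fun i k => f i.+1 (bump j k))).
rewrite !big_ord_recl big_ord0 /= /bump /= !(addn0, add1n, add0n); ring.
Qed.

(** Laplace expansion along the first two rows: [m 0 j k] and [m 2 j k] are the
minors of rows [0, 1] and rows [2, 3] on columns [j] and [k]. *)
Lemma det_fun4 {R : comNzRingType} (f : nat -> nat -> R) :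
  let m i j k := f i j * f i.+1 k - f i k * f i.+1 j in
  \det (\matrix_(i < 4, j < 4) f i j) =
    m 0 0 1 * m 2 2 3 - m 0 0 2 * m 2 1 3 + m 0 0 3 * m 2 1 2
  + m 0 1 2 * m 2 0 3 - m 0 1 3 * m 2 0 2 + m 0 2 3 * m 2 0 1.
Proof.
move=> m; rewrite det_fun_expand.
under eq_bigr => j _ do rewrite (det_fun3 (fun i k => f i.+1 (bump j k))).
rewrite !big_ord_recl big_ord0 /= /bump /= !(addn0, add1n, add0n) /m; ring.
Qed.

Lemma char_poly_rows4 {R : realType} (rows : seq (seq R)) :
  let f i j := 'X *+ (i == j) - (nth 0 (nth [::] rows i) j)%:P in
  let m i j k := f i j * f i.+1 k - f i k * f i.+1 j in
  char_poly (mx_of_rows 4 4 rows) =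
    m 0 0 1 * m 2 2 3 - m 0 0 2 * m 2 1 3 + m 0 0 3 * m 2 1 2
  + m 0 1 2 * m 2 0 3 - m 0 1 3 * m 2 0 2 + m 0 2 3 * m 2 0 1.
Proof.
move=> f m; rewrite -(det_fun4 f); congr (\det _).
by apply/matrixP => i j; rewrite !mxE.
Qed.

Lemma gramA {R : realType} : matA R *m (matA R)^T = mx_of_rows 4 4
  [:: [:: 4; 2; 1; 2]; [:: 2; 2; 1; 1]; [:: 1; 1; 1; 1]; [:: 2; 1; 1; 2]].
Proof.
apply/matrixP => i j; rewrite !mxE !big_ord_recl big_ord0 !mxE /=.
by case: i => -[|[|[|[|//]]]] ?; case: j => -[|[|[|[|//]]]] ? /=; ring.
Qed.

Lemma char_polyA {R : realType} :
  char_poly (matA R *m (matA R)^T) = ('X - 1) ^+ 2 * ('X ^+ 2 - 7%:P * 'X + 1).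
Proof. by rewrite gramA char_poly_rows4 /= ?mulr1n ?mulr0n; ring. Qed.

Lemma gramB {R : realType} : matB R *m (matB R)^T = mx_of_rows 4 4
  [:: [:: 4; 2; 1; 0]; [:: 2; 2; 1; 1]; [:: 1; 1; 1; 1]; [:: 0; 1; 1; 2]].
Proof.
apply/matrixP => i j; rewrite !mxE !big_ord_recl big_ord0 !mxE /=.
by case: i => -[|[|[|[|//]]]] ?; case: j => -[|[|[|[|//]]]] ? /=; ring.
Qed.

Lemma char_polyB {R : realType} :
  char_poly (matB R *m (matB R)^T) =
  ('X ^+ 2 - 3%:P * 'X + 1) * ('X ^+ 2 - 6%:P * 'X + 1).
Proof. by rewrite gramB char_poly_rows4 /= ?mulr1n ?mulr0n; ring. Qed.

(** * Eigenvalues and power sums *)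

Lemma cosh2_factor {R : realType} (t : R) :
  ('X - (expR t)%:P) * ('X - (expR (- t))%:P) = 'X ^+ 2 - (cosh2 t)%:P * 'X + 1.
Proof.
have E : (expR t)%:P * (expR (- t))%:P = 1 :> {poly R}.
  by rewrite -polyCM expRN divff ?gt_eqF ?expR_gt0.
by rewrite /cosh2 -E; ring.
Qed.

(** The eigenvalues are determined up to order by any factorization of the
characteristic polynomial into monic linear factors. *)
Lemma eigenvalues_perm {R : realType} {n : nat} {M : 'M[R]_n} {x : n.-tuple R}
    (s : seq R) :
  eigenvalues_of M x -> char_poly M = \prod_(z <- s) ('X - z%:P) ->
  perm_eq x s.
Proof.
by move=> Mx Ms; apply: prod_XsubC_eq; rewrite -Ms Mx big_tuple.
Qed.

Lemma big_seq4 {T : Type} {V : nmodType} (F : T -> V) (x y z w : T) :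
  \sum_(i <- [:: x; y; z; w]) F i = (F x + F y) + (F z + F w).
Proof. by rewrite !big_cons big_nil addr0 addrA. Qed.

Lemma sum_powR_expR {R : realType} (t p : R) :
  expR t `^ p + expR (- t) `^ p = cosh2 (t * p).
Proof. by rewrite -!expRM mulNr. Qed.

Theorem mainTheorem2 (R : realType) (x y : 4.-tuple R)
  (hx : eigenvalues_of (matA R *m (matA R)^T) x)
  (hy : eigenvalues_of (matB R *m (matB R)^T) y) :
  power_majorized y x.
Proof.
have [a a0 aE] : exists2 a : R, 0 <= a & cosh2 a = 7 by apply: cosh2_surj; lra.
have [b b0 bE] : exists2 b : R, 0 <= b & cosh2 b = 3 by apply: cosh2_surj; lra.
have [c c0 cE] : exists2 c : R, 0 <= c & cosh2 c = 6 by apply: cosh2_surj; lra.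
have xP : perm_eq x [:: expR a; expR (- a); 1; 1].
  apply: (eigenvalues_perm _ hx).
  by rewrite char_polyA -aE -cosh2_factor !big_cons big_nil; ring.
have yP : perm_eq y [:: expR b; expR (- b); expR c; expR (- c)].
  apply: (eigenvalues_perm _ hy).
  by rewrite char_polyB -bE -cE -!cosh2_factor !big_cons big_nil; ring.
have sumx p : \sum_(i < 4) tnth x i `^ p = cosh2 (a * p) + 2.
  rewrite -(big_tuple _ _ x xpredT (fun z => z `^ p)) (perm_big _ xP) /=.
  by rewrite big_seq4 sum_powR_expR !powR1.
have sumy p : \sum_(i < 4) tnth y i `^ p = cosh2 (b * p) + cosh2 (c * p).
  rewrite -(big_tuple _ _ y xpredT (fun z => z `^ p)) (perm_big _ yP) /=.
  by rewrite big_seq4 !sum_powR_expR.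
have ba : b < a by apply: cosh2_lt => //; lra.
have ca : c < a by apply: cosh2_lt => //; lra.
have F1 : cosh2 a + 2 = cosh2 b + cosh2 c by lra.
have ineq p := cosh2_ineq a b c p b0 ba c0 ca F1.
split=> [i|i|p p1|p p0 p1].
- have := mem_tnth i y; rewrite (perm_mem yP) !inE.
  by case/or4P => /eqP ->; exact: expR_gt0.
- have := mem_tnth i x; rewrite (perm_mem xP) !inE.
  by case/or4P => /eqP ->; rewrite ?expR_gt0.
- by rewrite sumx sumy; have [+ _] := ineq p; apply.
- by rewrite sumx sumy; have [_] := ineq p; apply; rewrite ltW.
Qed.
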